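(* Let $\mathbb{C}$ be a category with finite limits, let $H:\mathbb{M}\to\mathbb{C}$ be the inclusion of a full reflective subcategory, with reflector (left adjoint) $I:\mathbb{C}\to\mathbb{M}$ and unit $\eta:1_{\mathbb{C}}\to HI$. Let $U:\mathbb{C}\to\mathbf{Set}$ be a functor such that: (a) $U$ preserves finite limits; (b) $UH$ reflects isomorphisms; (c) $U(\eta_C):U(C)\to UHI(C)$ is surjective for every object $C\in\mathbb{C}$; (d) for every object $M\in\mathbb{M}$ and $T$ a terminal object of $\mathbb{C}$, the map $\mathbb{C}(T,M)\to\mathbf{Set}(U(T),U(M))$, $f\mapsto U(f)$, is surjective. Then the reflection $I\dashv H$ is semi-left-exact if and only if $HI(C_\mu)\cong T$ for every object $C\in\mathbb{C}$ and every morphism $\mu:T\to HI(C)$ from a terminal object $T$ of $\mathbb{C}$, where $C_\mu$ is the connected component of $\mu$.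
   Context: Connected component: for $C\in\mathbb{C}$ and a morphism $\mu:T\to HI(C)$ with $T$ terminal in $\mathbb{C}$, the connected component of $\mu$ is the pullback $C_\mu=C\times_{HI(C)}T$ of $\mu$ along the unit morphism $\eta_C:C\to HI(C)$. Semi-left-exact (also called admissible): the reflection $I\dashv H$ is semi-left-exact if $I$ preserves all pullback squares obtained by pulling back a morphism $g:M\to HI(C)$, with $M\in\mathbb{M}$, along a unit morphism $\eta_C:C\to HI(C)$, for all $C\in\mathbb{C}$. Conventions: objects of $\mathbb{M}$ are regarded as objects of $\mathbb{C}$ via $H$. Without loss of generality, the unit is chosen so that the counit is an identity, $IH=1_{\mathbb{M}}$, and the terminal object $T$ of $\mathbb{C}$ is chosen in $\mathbb{M}$. *)

(* Defs.v *)
From Stdlib Require Import List FinFun.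

Set Implicit Arguments.
Unset Strict Implicit.
Unset Printing Implicit Defensive.

Declare Scope cat_scope.
Delimit Scope cat_scope with cat.
Local Open Scope cat_scope.

Record category := Category {
  obj :> Type;
  hom : obj -> obj -> Type;
  idc : forall x, hom x x;
  comp : forall x y z, hom y z -> hom x y -> hom x z;
  comp1f : forall x y (f : hom x y), comp (idc y) f = f;
  compf1 : forall x y (f : hom x y), comp f (idc x) = f;
  compA : forall x y z t (h : hom z t) (g : hom y z) (f : hom x y),
    comp h (comp g f) = comp (comp h g) f }.

Arguments hom {_} _ _.
Arguments idc {_} _.
Arguments comp {_ _ _ _} _ _.

Notation "g '\;o' f" := (comp g f)
  (at level 40, left associativity) : cat_scope.

(* [SET] consists of the types of a fixed universe, with all functions. *)
Definition SET : category :=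
  @Category Type (fun A B => A -> B) (fun _ a => a)
    (fun _ _ _ g f a => g (f a))
    (fun _ _ _ => eq_refl) (fun _ _ _ => eq_refl)
    (fun _ _ _ _ _ _ _ => eq_refl).

Definition full_subcategory (C : category) (P : C -> Prop) : category :=
  @Category {x : C | P x} (fun x y => hom (proj1_sig x) (proj1_sig y))
    (fun x => idc (proj1_sig x)) (fun _ _ _ g f => g \;o f)
    (fun _ _ f => comp1f f) (fun _ _ f => compf1 f)
    (fun _ _ _ _ h g f => compA h g f).

Record functor (C D : category) := Functor {
  fobj :> C -> D;
  fmap : forall x y, hom x y -> hom (fobj x) (fobj y);
  fmap1 : forall x, fmap (idc x) = idc (fobj x);
  fmapM : forall x y z (g : hom y z) (f : hom x y),
    fmap (g \;o f) = fmap g \;o fmap f }.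

Arguments fmap {_ _} _ {_ _} _.

Definition functor_id (C : category) : functor C C :=
  @Functor C C (fun x => x) (fun _ _ f => f)
    (fun _ => eq_refl) (fun _ _ _ _ _ => eq_refl).

Definition functor_comp (C D E : category) (G : functor D E) (F : functor C D) :
  functor C E.
Proof.
refine (@Functor C E (fun x => G (F x)) (fun _ _ f => fmap G (fmap F f)) _ _).
- intros x; rewrite fmap1; apply fmap1.
- intros x y z g f; rewrite fmapM; apply fmapM.
Defined.

Definition inclusion (C : category) (P : C -> Prop) :
    functor (full_subcategory P) C :=
  @Functor (full_subcategory P) C (@proj1_sig _ _) (fun _ _ f => f)
    (fun _ => eq_refl) (fun _ _ _ _ _ => eq_refl).

Record nat_trans (C D : category) (F G : functor C D) := NatTrans {
  component :> forall x, hom (F x) (G x);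
  naturality : forall x y (f : hom x y),
    component y \;o fmap F f = fmap G f \;o component x }.

Record adjunction (C D : category) (L : functor C D) (R : functor D C) :=
  Adjunction {
  adj_unit : nat_trans (functor_id C) (functor_comp R L);
  adj_counit : nat_trans (functor_comp L R) (functor_id D);
  triangleL : forall x : C, adj_counit (L x) \;o fmap L (adj_unit x) = idc (L x);
  triangleR : forall y : D, fmap R (adj_counit y) \;o adj_unit (R y) = idc (R y) }.

Section Notions.
Variable C : category.

Definition is_iso (x y : C) (f : hom x y) : Prop :=
  exists g : hom y x, g \;o f = idc x /\ f \;o g = idc y.

Definition isomorphic (x y : C) : Prop := exists f : hom x y, is_iso f.

Definition is_terminal (t : C) : Prop :=
  forall x : C, exists! f : hom x t, True.

Definition is_pullback (x y z p : C) (f : hom x z) (g : hom y z)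
    (p1 : hom p x) (p2 : hom p y) : Prop :=
  f \;o p1 = g \;o p2 /\
  forall (q : C) (q1 : hom q x) (q2 : hom q y), f \;o q1 = g \;o q2 ->
    exists! u : hom q p, p1 \;o u = q1 /\ p2 \;o u = q2.

Record cone (J : category) (D : functor J C) := Cone {
  apex : C;
  leg : forall j : J, hom apex (D j);
  legE : forall (i j : J) (f : hom i j), fmap D f \;o leg i = leg j }.

Definition is_limit (J : category) (D : functor J C) (K : cone D) : Prop :=
  forall K' : cone D, exists! u : hom (apex K') (apex K),
    forall j : J, leg K j \;o u = leg K' j.

End Notions.

Definition map_cone (C D J : category) (F : functor C D) (X : functor J C)
  (K : cone X) : cone (functor_comp F X).
Proof.
refine (@Cone D J (functor_comp F X) (F (apex K)) (fun j => fmap F (leg K j)) _).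
intros i j f; simpl; rewrite <- fmapM; rewrite legE; reflexivity.
Defined.

Definition finite_category (J : category) : Prop :=
  Finite J /\ forall i j : J, Finite (hom i j).

Definition has_finite_limits (C : category) : Prop :=
  forall (J : category) (X : functor J C), finite_category J ->
    exists K : cone X, is_limit K.

Definition preserves_finite_limits (C D : category) (F : functor C D) : Prop :=
  forall (J : category) (X : functor J C) (K : cone X), finite_category J ->
    is_limit K -> is_limit (map_cone F K).

Definition reflects_isos (C D : category) (F : functor C D) : Prop :=
  forall (x y : C) (f : hom x y), is_iso (fmap F f) -> is_iso f.

Section Reflection.
Variables (C : category) (P : C -> Prop).
Variables (I : functor C (full_subcategory P)) (adj : adjunction I (inclusion P)).

Definition semi_left_exact : Prop :=
  forall (X : C) (M : full_subcategory P)
    (g : hom (inclusion P M) (inclusion P (I X)))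
    (Q : C) (p1 : hom Q X) (p2 : hom Q (inclusion P M)),
    is_pullback (adj_unit adj X) g p1 p2 ->
    is_pullback (fmap I (adj_unit adj X)) (fmap I g) (fmap I p1) (fmap I p2).

(* Pullbacks are determined up to isomorphism only, so being the connected
   component of [mu] is a property of [Xmu] together with its projections;
   it is meant for [T] terminal. *)
Definition is_connected_component (X T : C) (mu : hom T (inclusion P (I X)))
    (Xmu : C) (p1 : hom Xmu X) (p2 : hom Xmu T) : Prop :=
  is_pullback (adj_unit adj X) mu p1 p2.

End Reflection.

(* Main.v *)
Require Import Defs.
From Stdlib Require Import FinFun.
From Stdlib Require Import List.
From Stdlib Require Import FunctionalExtensionality IndefiniteDescription.

(** Write [eta] and [eps] for the unit and the counit.  Because the right
    adjoint is a full inclusion, [eps] is invertible, hence so is [I eta].  An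
    [I]-image of a pullback square along [eta X] therefore has an invertible
    side, and such a commutative square is a pullback exactly when the opposite
    side is invertible ([pullback_of_iso], [square_of_isos_is_pullback]).
    So semi-left-exactness says that [I p2] is invertible whenever [p2] is a
    pullback of some [eta X] along a map out of an object of the subcategory.

    Assume semi-left-exactness.  A terminal [T] is isomorphic to [I T], so a
    map [mu] out of [T] may be regarded as a map out of [I T].  The connected
    component of [mu] is then the vertex of a pullback of the kind just
    described, and invertibility of [I p2] gives [I Xmu = I T = T] up to
    isomorphism.

    Conversely, let [Q] be the pullback of [eta X] along [g : M -> I X].  By
    reflection of isomorphisms it is enough that [U] sends
    [k = eps \;o I p2 : I Q -> M] to a bijection.
    It is surjective because [k \;o eta Q = p2] and [U p2] is a pullback of the
    surjection [U (eta X)].  For injectivity, the fibre of [U p2] over a point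
    [m] of [U M] is computed inside [C]: the point is the image of some
    [f : T -> M], and the fibre is [U] of the connected component of [g \;o f].
    The reflection of this component is terminal, so all of the fibre is
    identified by [U (eta Q)] ([unit_collapses_fibre]).  As [U (eta Q)] is
    surjective, the fibre of [U k] over [m] is the image of that of [U p2], that
    is, one point. *)

Set Implicit Arguments.
Unset Strict Implicit.
Unset Printing Implicit Defensive.

Local Open Scope cat_scope.

(** * Isomorphisms, terminal objects and pullback squares *)

Section Squares.
Variable C : category.

Lemma is_iso_comp (x y z : C) (g : hom y z) (f : hom x y) :
  is_iso g -> is_iso f -> is_iso (g \;o f).
Proof.
intros [g' [g'g gg']] [f' [f'f ff']]; exists (f' \;o g'); split.
- rewrite compA, <- (compA f' g' g), g'g, compf1; exact f'f.
- rewrite compA, <- (compA g f f'), ff', compf1; exact gg'.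
Qed.

Lemma is_iso_section (x y : C) (f : hom x y) (s : hom y x) :
  is_iso f -> f \;o s = idc y -> is_iso s.
Proof.
intros [f' [f'f ff']] fs.
assert (s_eq : s = f').
{ rewrite <- (comp1f s), <- f'f, <- compA, fs; apply compf1. }
exists f; rewrite s_eq; split; assumption.
Qed.

Lemma is_iso_cancel_left (x y z : C) (g : hom y z) (f : hom x y) :
  is_iso g -> is_iso (g \;o f) -> is_iso f.
Proof.
intros [g' [g'g gg']] gf_iso.
rewrite <- (comp1f f), <- g'g, <- compA.
apply is_iso_comp; [exists g; split; assumption | exact gf_iso].
Qed.

Lemma terminal_hom (t : C) (t_term : is_terminal t) (x : C) :
  exists f : hom x t, True.
Proof. destruct (t_term x) as [f _]; exists f; exact Logic.I. Qed.

Lemma terminal_hom_eq (t : C) (t_term : is_terminal t) (x : C)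
  (f g : hom x t) : f = g.
Proof.
destruct (t_term x) as [h [_ h_uniq]].
rewrite <- (h_uniq f Logic.I); apply h_uniq; exact Logic.I.
Qed.

Lemma terminal_isomorphic (s t : C) :
  isomorphic s t -> is_terminal t -> is_terminal s.
Proof.
intros [f [g [gf fg]]] t_term x.
destruct (terminal_hom t_term x) as [h _].
exists (g \;o h); split; [exact Logic.I | intros k _].
rewrite (terminal_hom_eq t_term h (f \;o k)), compA, gf; apply comp1f.
Qed.

Lemma pullback_of_iso (x y z p : C) (f : hom x z) (g : hom y z)
    (p1 : hom p x) (p2 : hom p y) :
  is_pullback f g p1 p2 -> is_iso f -> is_iso p2.
Proof.
intros [sq univ] [f' [f'f ff']].
assert (sq' : f \;o (f' \;o g) = g \;o idc y)
  by (rewrite compA, ff', comp1f, compf1; reflexivity).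
destruct (univ y _ _ sq') as [u [[p1u p2u] _]].
exists u; split; [ | exact p2u].
destruct (univ p p1 p2 sq) as [v [_ v_uniq]].
transitivity v; [symmetry | ]; apply v_uniq; split.
- rewrite compA, p1u, <- compA, <- sq, compA, f'f; apply comp1f.
- rewrite compA, p2u; apply comp1f.
- apply compf1.
- apply compf1.
Qed.

Lemma square_of_isos_is_pullback (x y z p : C) (f : hom x z) (g : hom y z)
    (p1 : hom p x) (p2 : hom p y) :
  f \;o p1 = g \;o p2 -> is_iso f -> is_iso p2 -> is_pullback f g p1 p2.
Proof.
intros sq [f' [f'f ff']] [r [rp2 p2r]]; split; [exact sq | ].
intros q q1 q2 sq'; exists (r \;o q2); split; [split | ].
- rewrite <- (comp1f (p1 \;o _)), <- f'f, <- (compA f' f), (compA f p1), sq.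
  rewrite <- (compA g p2), (compA p2 r), p2r, comp1f, <- sq', compA, f'f.
  apply comp1f.
- rewrite compA, p2r; apply comp1f.
- intros u [_ p2u]; rewrite <- p2u, compA, rp2; apply comp1f.
Qed.

Lemma pullback_replace_corner (x y y' z p : C) (f : hom x z) (g : hom y z)
    (g' : hom y' z) (e : hom y y') (p1 : hom p x) (p2 : hom p y) :
  is_pullback f g p1 p2 -> is_iso e -> g' \;o e = g ->
  is_pullback f g' p1 (e \;o p2).
Proof.
intros [sq univ] [e' [e'e ee']] g'e; split.
- rewrite compA, g'e; exact sq.
- intros q q1 q2 sq'.
  destruct (univ q q1 (e' \;o q2)) as [u [[p1u p2u] u_uniq]].
  { rewrite <- g'e, <- compA, (compA e e'), ee', comp1f; exact sq'. }
  exists u; split; [split | ].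
  + exact p1u.
  + rewrite <- compA, p2u, compA, ee'; apply comp1f.
  + intros v [p1v p2v]; apply u_uniq; split; [exact p1v | ].
    rewrite <- p2v, <- compA, (compA e' e), e'e; symmetry; apply comp1f.
Qed.

End Squares.

Lemma functor_is_iso (C D : category) (F : functor C D) (x y : C)
  (f : hom x y) : is_iso f -> is_iso (fmap F f).
Proof.
intros [g [gf fg]]; exists (fmap F g).
split; rewrite <- fmapM, ?gf, ?fg; apply fmap1.
Qed.

(** * Pullbacks and terminal objects as finite limits *)

Inductive cospan_obj : Type := Left | Right | Base.

Definition cospan_hom (i j : cospan_obj) : Type :=
  match i, j with
  | Left, Left | Right, Right | Base, Base | Left, Base | Right, Base => unit
  | _, _ => Empty_set
  end.

Definition cospan_idc (i : cospan_obj) : cospan_hom i i :=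
  match i with Left | Right | Base => tt end.

Definition cospan_comp (i j k : cospan_obj) :
  cospan_hom j k -> cospan_hom i j -> cospan_hom i k.
Proof. destruct i, j, k; simpl; tauto. Defined.

Definition cospan_cat : category.
Proof.
refine (@Category cospan_obj cospan_hom cospan_idc cospan_comp _ _ _).
- intros [] [] []; reflexivity.
- intros [] [] []; reflexivity.
- intros [] [] [] [] [] [] []; reflexivity.
Defined.

Definition left_base : @hom cospan_cat Left Base := tt.
Definition right_base : @hom cospan_cat Right Base := tt.

Lemma cospan_cat_finite : finite_category cospan_cat.
Proof.
split.
- exists (Left :: Right :: Base :: nil); intros []; simpl; tauto.
- intros [] []; (exists nil; intros []; fail) ||
    (exists (tt :: nil); intros []; simpl; tauto).
Qed.

Section Cospans.
Variable C : category.

Definition cospan (x y z : C) (f : hom x z) (g : hom y z) :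
  functor cospan_cat C.
Proof.
pose (ob (i : cospan_obj) := match i with Left => x | Right => y | Base => z end).
refine (@Functor cospan_cat C ob
  (fun i j => match i, j return cospan_hom i j -> hom (ob i) (ob j) with
    | Left, Base => fun _ => f
    | Right, Base => fun _ => g
    | Left, Left | Right, Right | Base, Base => fun _ => idc _
    | _, _ => fun e : Empty_set => match e with end
    end) _ _).
- intros []; reflexivity.
- intros [] [] [] [] []; simpl; rewrite ?comp1f, ?compf1; reflexivity.
Defined.

Variable X : functor cospan_cat C.

Definition cospan_cone (q : C) (q1 : hom q (X Left)) (q2 : hom q (X Right))
  (sq : fmap X left_base \;o q1 = fmap X right_base \;o q2) : cone X.
Proof.
refine (@Cone C cospan_cat X q
  (fun i => match i return hom q (X i) with
    | Left => q1 | Right => q2 | Base => fmap X left_base \;o q1 end) _).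
intros [] [] [].
- exact (eq_trans (f_equal (fun h => h \;o q1) (fmap1 X Left)) (comp1f q1)).
- reflexivity.
- exact (eq_trans (f_equal (fun h => h \;o q2) (fmap1 X Right)) (comp1f q2)).
- symmetry; exact sq.
- exact (eq_trans (f_equal (fun h => h \;o _) (fmap1 X Base)) (comp1f _)).
Defined.

(** Stated for an arbitrary diagram and not only for [cospan f g], so that it
    applies to the image of such a diagram under a functor. *)
Lemma cospan_limitP (K : cone X) :
  is_limit K <->
  is_pullback (fmap X left_base) (fmap X right_base)
    (leg K Left) (leg K Right).
Proof.
split.
- intros K_lim; split; [rewrite !legE; reflexivity | ].
  intros q q1 q2 sq.
  destruct (K_lim (cospan_cone sq)) as [u [uE u_uniq]].
  exists u; split; [exact (conj (uE Left) (uE Right)) | ].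
  intros v [v1 v2]; apply u_uniq; intros []; [exact v1 | exact v2 | ].
  rewrite <- (legE K left_base), <- compA.
  exact (f_equal (comp (fmap X left_base)) v1).
- intros [_ univ] K'.
  destruct (univ (apex K') (leg K' Left) (leg K' Right)) as [u [[u1 u2] u_uniq]].
  { rewrite !legE; reflexivity. }
  exists u; split.
  + intros []; [exact u1 | exact u2 | ].
    rewrite <- (legE K left_base), <- compA, u1; apply legE.
  + intros v vE; apply u_uniq; split; apply vE.
Qed.

End Cospans.

Lemma pullback_exists (C : category) (hC : has_finite_limits C) (x y z : C)
    (f : hom x z) (g : hom y z) :
  exists (p : C) (p1 : hom p x) (p2 : hom p y), is_pullback f g p1 p2.
Proof.
destruct (hC _ (cospan f g) cospan_cat_finite) as [K K_lim].
exists (apex K), (leg K Left), (leg K Right).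
exact (proj1 (cospan_limitP K) K_lim).
Qed.

Lemma preserves_pullback (C D : category) (F : functor C D)
    (hF : preserves_finite_limits F) (x y z p : C) (f : hom x z) (g : hom y z)
    (p1 : hom p x) (p2 : hom p y) :
  is_pullback f g p1 p2 ->
  is_pullback (fmap F f) (fmap F g) (fmap F p1) (fmap F p2).
Proof.
intros pb.
pose (K := @cospan_cone C (cospan f g) p p1 p2 (proj1 pb)).
exact (proj1 (cospan_limitP (map_cone F K))
  (hF _ _ K cospan_cat_finite (proj2 (cospan_limitP K) pb))).
Qed.

Definition empty_cat : category.
Proof.
refine (@Category Empty_set (fun _ _ => Empty_set)
  (fun i => i) (fun i _ _ _ _ => i) _ _ _); intros [].
Defined.

Lemma empty_cat_finite : finite_category empty_cat.
Proof. split; [exists nil; intros [] | intros []]. Qed.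

Definition empty_diagram (C : category) : functor empty_cat C.
Proof.
refine (@Functor empty_cat C (fun i : Empty_set => match i with end)
  (fun i : Empty_set => match i with end) _ _); intros [].
Defined.

Definition empty_cone (C : category) (X : functor empty_cat C) (t : C) :
  cone X.
Proof.
refine (@Cone C empty_cat X t (fun i : Empty_set => match i with end) _).
intros [].
Defined.

Lemma empty_limitP (C : category) (X : functor empty_cat C) (K : cone X) :
  is_limit K <-> is_terminal (apex K).
Proof.
split.
- intros K_lim x; destruct (K_lim (empty_cone X x)) as [u [_ u_uniq]].
  exists u; split; [exact Logic.I | intros v _; apply u_uniq; intros []].
- intros term K'; destruct (term (apex K')) as [u [_ u_uniq]].
  exists u; split; [intros [] | intros v _; exact (u_uniq v Logic.I)].
Qed.

Lemma terminal_exists (C : category) (hC : has_finite_limits C) :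
  exists t : C, is_terminal t.
Proof.
destruct (hC _ (empty_diagram C) empty_cat_finite) as [K K_lim].
exists (apex K); exact (proj1 (empty_limitP K) K_lim).
Qed.

Lemma preserves_terminal (C D : category) (F : functor C D)
    (hF : preserves_finite_limits F) (t : C) :
  is_terminal t -> is_terminal (F t).
Proof.
intros t_term; pose (K := empty_cone (empty_diagram C) t).
exact (proj1 (empty_limitP (map_cone F K))
  (hF _ _ K empty_cat_finite (proj2 (empty_limitP K) t_term))).
Qed.

(** * Limits and bijections of sets *)

Lemma SET_pullback_lift (A B D Q : SET) (f : hom A D) (g : hom B D)
    (p1 : hom Q A) (p2 : hom Q B) (pb : is_pullback f g p1 p2) (a : A) (b : B) :
  f a = g b -> exists c : Q, p1 c = a /\ p2 c = b.
Proof.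
intros ab.
destruct (proj2 pb (unit : SET) (fun _ => a) (fun _ => b)) as [u [[u1 u2] _]].
{ apply functional_extensionality; intros ?; exact ab. }
exists (u tt); split.
- exact (f_equal (fun h => h tt) u1).
- exact (f_equal (fun h => h tt) u2).
Qed.

Lemma SET_pullback_inj (A B D Q : SET) (f : hom A D) (g : hom B D)
    (p1 : hom Q A) (p2 : hom Q B) (pb : is_pullback f g p1 p2) (c c' : Q) :
  p1 c = p1 c' -> p2 c = p2 c' -> c = c'.
Proof.
intros c1 c2.
destruct (proj2 pb (unit : SET) (fun _ => p1 c) (fun _ => p2 c))
  as [u [_ u_uniq]].
{ apply functional_extensionality; intros ?.
  exact (f_equal (fun h => h c) (proj1 pb)). }
assert (uc : u = (fun _ => c)) by (apply u_uniq; split; reflexivity).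
assert (uc' : u = (fun _ => c')).
{ apply u_uniq; split; apply functional_extensionality; intros ?;
    symmetry; assumption. }
exact (f_equal (fun h => h tt) (eq_trans (eq_sym uc) uc')).
Qed.

Lemma SET_terminal_point (A : SET) (A_term : is_terminal A) :
  exists a : A, True.
Proof.
destruct (terminal_hom A_term (unit : SET)) as [h _].
exists (h tt); exact Logic.I.
Qed.

Lemma SET_terminal_eq (A : SET) (A_term : is_terminal A) (a b : A) : a = b.
Proof.
exact (f_equal (fun h => h tt)
  (@terminal_hom_eq _ _ A_term (unit : SET) (fun _ => a) (fun _ => b))).
Qed.

Lemma SET_bijective_iso (A B : SET) (f : hom A B) :
  Injective f -> Surjective f -> is_iso f.
Proof.
intros f_inj f_surj.
pose (g b := proj1_sig (constructive_indefinite_description _ (f_surj b))).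
assert (fg : forall b, f (g b) = b)
  by (intros b;
      exact (proj2_sig (constructive_indefinite_description _ (f_surj b)))).
exists g; split; apply functional_extensionality.
- intros a; apply f_inj; exact (fg (f a)).
- exact fg.
Qed.

(** * Units and counits of reflections *)

Section Adjunctions.
Variables (C D : category) (L : functor C D) (R : functor D C).
Variable adj : adjunction L R.

Lemma adjunct_unit (x : C) (y : D) (f : hom x (R y)) :
  fmap R (adj_counit adj y \;o fmap L f) \;o adj_unit adj x = f.
Proof.
rewrite fmapM, <- compA.
transitivity (fmap R (adj_counit adj y) \;o (adj_unit adj (R y) \;o f)).
- exact (f_equal (comp (fmap R (adj_counit adj y)))
    (eq_sym (naturality (adj_unit adj) f))).
- rewrite compA.
  exact (eq_trans (f_equal (fun h => h \;o f) (triangleR adj y)) (comp1f f)).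
Qed.

Lemma unit_cancel (x : C) (y : D) (k k' : hom (L x) y) :
  fmap R k \;o adj_unit adj x = fmap R k' \;o adj_unit adj x -> k = k'.
Proof.
assert (transpose : forall h : hom (L x) y,
  h = adj_counit adj y \;o fmap L (fmap R h \;o adj_unit adj x)).
{ intros h; rewrite fmapM, compA.
  transitivity (h \;o (adj_counit adj (L x) \;o fmap L (adj_unit adj x))).
  - rewrite triangleL; symmetry; apply compf1.
  - rewrite compA.
    exact (f_equal (fun e => e \;o fmap L (adj_unit adj x))
      (eq_sym (naturality (adj_counit adj) h))). }
intros kk'; rewrite (transpose k), (transpose k'), kk'; reflexivity.
Qed.

Hypothesis R_full : forall (x y : D) (f : hom (R x) (R y)),
  exists h : hom x y, fmap R h = f.
Hypothesis R_faithful : forall (x y : D) (h h' : hom x y),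
  fmap R h = fmap R h' -> h = h'.

(** By fullness the unit at [R y] comes from a map [y -> L (R y)], and the
    triangle identity makes that map the inverse of the counit. *)
Lemma counit_is_iso (y : D) : is_iso (adj_counit adj y).
Proof.
destruct (R_full (adj_unit adj (R y))) as [e eE].
exists e; split.
- apply unit_cancel; rewrite fmapM, fmap1, comp1f, <- compA, triangleR; simpl.
  rewrite eE; apply compf1.
- apply R_faithful; rewrite fmapM, fmap1; simpl.
  rewrite eE; apply triangleR.
Qed.

Lemma map_unit_is_iso (x : C) : is_iso (fmap L (adj_unit adj x)).
Proof. exact (is_iso_section (counit_is_iso (L x)) (triangleL adj x)). Qed.

(** A retraction of the unit is a two-sided inverse, by the uniqueness in the
    universal property of the unit; at a terminal object there is one. *)
Lemma unit_terminal_is_iso (t : C) :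
  is_terminal t -> is_iso (adj_unit adj t).
Proof.
intros t_term.
destruct (terminal_hom t_term (R (L t))) as [r _].
assert (r_eta : r \;o adj_unit adj t = idc t)
  by apply (terminal_hom_eq t_term).
exists r; split; [exact r_eta | ].
destruct (R_full (adj_unit adj t \;o r)) as [h hE].
assert (h_id : h = idc (L t)).
{ apply unit_cancel.
  rewrite hE, fmap1, comp1f, <- compA.
  exact (eq_trans (f_equal (comp (adj_unit adj t)) r_eta) (compf1 _)). }
refine (eq_trans (eq_sym hE) _); rewrite h_id; exact (fmap1 R (L t)).
Qed.

End Adjunctions.

Lemma inclusion_full (C : category) (P : C -> Prop)
    (x y : full_subcategory P) (f : hom (inclusion P x) (inclusion P y)) :
  exists h : hom x y, fmap (inclusion P) h = f.
Proof. exists f; reflexivity. Qed.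

Lemma inclusion_faithful (C : category) (P : C -> Prop)
    (x y : full_subcategory P) (h h' : hom x y) :
  fmap (inclusion P) h = fmap (inclusion P) h' -> h = h'.
Proof. intros hh'; exact hh'. Qed.

(** * Semi-left-exactness and connected components *)

Section Reflections.
Variables (C : category) (P : C -> Prop).
Variables (I : functor C (full_subcategory P)).
Variable adj : adjunction I (inclusion P).

Lemma semi_left_exact_component (sle : semi_left_exact adj) (X T : C)
    (mu : hom T (inclusion P (I X))) (Xmu : C) (p1 : hom Xmu X)
    (p2 : hom Xmu T) :
  is_terminal T -> is_connected_component adj mu p1 p2 ->
  isomorphic (inclusion P (I Xmu)) T.
Proof.
intros T_term pb.
pose proof (unit_terminal_is_iso adj (@inclusion_full C P) T_term) as eta_iso.
destruct eta_iso as [s [s_eta eta_s]].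
assert (eta_iso : is_iso (adj_unit adj T)) by (exists s; split; assumption).
(* [T] itself need not satisfy [P], so it is replaced by [I T]. *)
assert (pb' : is_pullback (adj_unit adj X) (mu \;o s) p1
                (adj_unit adj T \;o p2)).
{ apply (pullback_replace_corner pb eta_iso).
  rewrite <- compA.
  exact (eq_trans (f_equal (comp mu) s_eta) (compf1 mu)). }
pose proof (pullback_of_iso (sle X (I T) (mu \;o s) Xmu p1 _ pb')
  (map_unit_is_iso adj (@inclusion_full C P) (@inclusion_faithful C P) X))
  as I_iso.
rewrite fmapM in I_iso.
apply is_iso_cancel_left in I_iso;
  [ | apply map_unit_is_iso; [apply inclusion_full | apply inclusion_faithful]].
exists (s \;o fmap (inclusion P) (fmap I p2)); apply is_iso_comp.
- exists (adj_unit adj T); split; assumption.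
- exact (functor_is_iso (inclusion P) I_iso).
Qed.

Variable U : functor C SET.
Hypothesis hC : has_finite_limits C.
Hypothesis hU : preserves_finite_limits U.
Hypothesis hsurj : forall X : C, Surjective (fmap U (adj_unit adj X)).
Hypothesis hpoint : forall (M : full_subcategory P) (T : C), is_terminal T ->
  Surjective (fun f : hom T (inclusion P M) => fmap U f).
Hypothesis component_terminal :
  forall (X T : C) (mu : hom T (inclusion P (I X)))
    (Xmu : C) (p1 : hom Xmu X) (p2 : hom Xmu T),
    is_terminal T -> is_connected_component adj mu p1 p2 ->
    isomorphic (inclusion P (I Xmu)) T.

Lemma map_comp_app (x y z : C) (g : hom y z) (f : hom x y) (a : U x) :
  fmap U (g \;o f) a = fmap U g (fmap U f a).
Proof. rewrite fmapM; reflexivity. Qed.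

(** The fibre of [U p2] is the underlying set of a connected component, whose
    reflection has only one point; this is where naturality of the unit along
    the inclusion of the component enters. *)
Lemma unit_collapses_fibre (X : C) (M : full_subcategory P)
    (g : hom (inclusion P M) (inclusion P (I X))) (Q : C) (p1 : hom Q X)
    (p2 : hom Q (inclusion P M)) (pb : is_pullback (adj_unit adj X) g p1 p2)
    (a b : U Q) :
  fmap U p2 a = fmap U p2 b ->
  fmap U (adj_unit adj Q) a = fmap U (adj_unit adj Q) b.
Proof.
intros ab.
destruct (terminal_exists hC) as [T T_term].
pose proof (preserves_terminal hU T_term) as UT_term.
destruct (SET_terminal_point UT_term) as [t _].
destruct (hpoint T_term (fun _ => fmap U p2 a)) as [f fE].
assert (f_point : forall s : U T, fmap U f s = fmap U p2 a)
  by (intros s; exact (f_equal (fun h => h s) fE)).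
destruct (pullback_exists hC (adj_unit adj X) (g \;o f))
  as [Xmu [r1 [r2 pbmu]]].
assert (sq : adj_unit adj X \;o r1 = g \;o (f \;o r2))
  by (rewrite compA; exact (proj1 pbmu)).
destruct (proj2 pb Xmu r1 (f \;o r2) sq) as [w [[p1w p2w] _]].
assert (lift : forall c : U Q, fmap U p2 c = fmap U p2 a ->
  exists d : U Xmu, fmap U w d = c).
{ intros c ca.
  destruct (SET_pullback_lift (preserves_pullback hU pbmu)
    (a := fmap U p1 c) (b := t)) as [d [d1 _]].
  - rewrite map_comp_app, f_point, <- ca.
    exact (f_equal (fun h => h c) (proj1 (preserves_pullback hU pb))).
  - exists d; apply (SET_pullback_inj (preserves_pullback hU pb));
      rewrite <- map_comp_app.
    + rewrite p1w; exact d1.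
    + rewrite p2w, map_comp_app, f_point; symmetry; exact ca. }
destruct (lift a eq_refl) as [a' <-].
destruct (lift b (eq_sym ab)) as [b' <-].
assert (unit_nat : forall d : U Xmu,
  fmap U (adj_unit adj Q) (fmap U w d) =
  fmap U (fmap (inclusion P) (fmap I w)) (fmap U (adj_unit adj Xmu) d)).
{ intros d; rewrite <- !map_comp_app.
  exact (f_equal (fun h => fmap U h d) (naturality (adj_unit adj) w)). }
rewrite !unit_nat; f_equal.
apply SET_terminal_eq, (preserves_terminal hU).
apply (terminal_isomorphic (component_terminal T_term pbmu) T_term).
Qed.

Lemma semi_left_exact_of_components
    (hUH : reflects_isos (functor_comp U (inclusion P))) :
  semi_left_exact adj.
Proof.
intros X M g Q p1 p2 pb.
apply square_of_isos_is_pullback.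
- rewrite <- !fmapM; exact (f_equal (fmap I) (proj1 pb)).
- apply map_unit_is_iso; [apply inclusion_full | apply inclusion_faithful].
- apply (is_iso_cancel_left (g := adj_counit adj M)).
  { apply counit_is_iso; [apply inclusion_full | apply inclusion_faithful]. }
  set (k := adj_counit adj M \;o fmap I p2).
  apply hUH; simpl.
  assert (kE : forall c : U Q,
    fmap U (fmap (inclusion P) k) (fmap U (adj_unit adj Q) c) = fmap U p2 c).
  { intros c; rewrite <- map_comp_app.
    exact (f_equal (fun h => fmap U h c) (adjunct_unit adj p2)). }
  apply SET_bijective_iso.
  + intros a b kab.
    destruct (hsurj a) as [a' <-]; destruct (hsurj b) as [b' <-].
    apply (unit_collapses_fibre pb).
    rewrite <- !kE; exact kab.
  + intros m.
    destruct (hsurj (fmap U g m)) as [x xE].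
    destruct (SET_pullback_lift (preserves_pullback hU pb) xE) as [c [_ c2]].
    exists (fmap U (adj_unit adj Q) c); rewrite <- c2; exact (kE c).
Qed.

End Reflections.

Theorem theorem4p1 (C : category) (hC : has_finite_limits C)
    (P : C -> Prop) (I : functor C (full_subcategory P))
    (adj : adjunction I (inclusion P))
    (U : functor C SET)
    (hU : preserves_finite_limits U)
    (hUH : reflects_isos (functor_comp U (inclusion P)))
    (hsurj : forall X : C, Surjective (fmap U (adj_unit adj X)))
    (hpoint : forall (M : full_subcategory P) (T : C), is_terminal T ->
      Surjective (fun f : hom T (inclusion P M) => fmap U f)) :
  semi_left_exact adj <->
  (forall (X T : C) (mu : hom T (inclusion P (I X)))
     (Xmu : C) (p1 : hom Xmu X) (p2 : hom Xmu T),
     is_terminal T -> is_connected_component adj mu p1 p2 ->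
     isomorphic (inclusion P (I Xmu)) T).
Proof.
split.
- exact (@semi_left_exact_component C P I adj).
- intros comp_term.
  exact (semi_left_exact_of_components hC hU hsurj hpoint comp_term hUH).
Qed.
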